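(* Let $x\in\mathbb{R}^n$, let $S\in\mathbb{R}^{q\times n}$ be a sampling matrix, let $\eta\in\mathbb{R}^q$ and $y=Sx+\eta$, and let $\mathcal F(\cdot;y)$ be the Gappy PMD reconstruction map with search box $\Theta\subset\mathbb{R}^d$ (all as defined in the context). Let $\widetilde\theta\in\Theta$ be a point at which $\mathcal F(\cdot;y)$ is differentiable, and put $$\widetilde x:=\mathcal F(\widetilde\theta;y),\qquad \widetilde e:=x-\widetilde x .$$ Let $\widetilde p$ be the dimension of $\operatorname{range}\bigl(D_\theta\mathcal F(\widetilde\theta;y)\bigr)$, let $\widetilde\Psi\in\mathbb{R}^{n\times\widetilde p}$ be any matrix whose columns form an orthonormal basis of this space, and put $$\widetilde\Psi_s:=S\widetilde\Psi,\qquad \widetilde e_\perp:=(I-\widetilde\Psi\widetilde\Psi^{\top})\widetilde e .$$ Assume $1\le\widetilde p\le q$ and $\operatorname{rank}(\widetilde\Psi_s)=\widetilde p$. With $$\widetilde\Lambda:=\lVert\widetilde\Psi_s^\dagger\rVert_2=\frac{1}{\sigma_{\min}(\widetilde\Psi_s)},\qquad \widetilde r_{\mathrm{stat}}:=\widetilde\Psi^{\top}S^{\top}(y-S\widetilde x),$$ the reconstruction error satisfies $$\widetilde e=\widetilde e_\perp-\widetilde\Psi\,\widetilde\Psi_s^\dagger(S\widetilde e_\perp+\eta)+\widetilde\Psi\,(\widetilde\Psi_s^{\top}\widetilde\Psi_s)^{-1}\widetilde r_{\mathrm{stat}},$$ $$\lVert\widetilde e\rVert_2\le\widetilde\Lambda\bigl(\lVert\widetilde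 e_\perp\rVert_2+\lVert\eta\rVert_2\bigr)+\widetilde\Lambda^2\lVert\widetilde r_{\mathrm{stat}}\rVert_2 .$$ Moreover, if $\widetilde\theta$ is an interior stationary point of the least-squares problem $\min_{\theta\in\Theta}\lVert y-S\mathcal F(\theta;y)\rVert_2^2$ (that is, $\widetilde\theta$ lies in the interior of $\Theta$ and the gradient of the objective vanishes there), then $\widetilde r_{\mathrm{stat}}=0$, so the corresponding terms vanish in the identity and in the bound; in particular $$\lVert\widetilde e\rVert_2\le\widetilde\Lambda\bigl(\lVert\widetilde e_\perp\rVert_2+\lVert\eta\rVert_2\bigr).$$
   Context: Notation: $\lVert\cdot\rVert_2$ is the Euclidean norm of vectors and the spectral norm of matrices; $A^\dagger$ is the Moore--Penrose inverse; $\sigma_{\min}(A)$ is the smallest singular value of a matrix $A$ with at least as many rows as columns (the $k$-th largest, if $A$ has $k$ columns). Sampling: $\mathcal S=\{i_1,\dots,i_q\}\subset\{1,\dots,n\}$ is a set of $q$ distinct indices and $S\in\mathbb{R}^{q\times n}$ is the matrix extracting these entries, i.e. its rows are the standard basis row vectors $e_{i_1}^\top,\dots,e_{i_q}^\top$; hence $SS^\top=I_q$. The measurement of a full state $x\in\mathbb{R}^n$ is $y=Sx+\eta$ with noise $\eta\in\mathbb{R}^q$. Gappy PMD (offline). From training snapshots $x_1,\dots,x_m\in\mathbb{R}^n$ let $\bar x$ be their mean, let $\Phi\in\mathbb{R}^{n\times r}$ consist of the $r$ leading left singular vectors of $[x_1-\bar x,\dots,x_m-\bar x]$ (so $\Phi^\top\Phi=I_r$),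 and put $a_j=\Phi^\top(x_j-\bar x)\in\mathbb{R}^r$, $u_j=x_j-\bar x-\Phi a_j$, $b_j=Su_j\in\mathbb{R}^q$. Let $d_{\mathcal M}(u_i,u_j)$ be the shortest-path distance in the $k_{\mathrm{nn}}$-nearest-neighbor graph of the $u_j$ with Euclidean edge lengths; set $W_{ij}=\exp(-d_{\mathcal M}^2(u_i,u_j)/\varepsilon)$ with $\varepsilon>0$, $\rho_i=\sum_jW_{ij}$, $\widetilde W_{ij}=W_{ij}/(\rho_i\rho_j)$, $P(i,j)=\widetilde W_{ij}/\sum_k\widetilde W_{ik}$. With eigenpairs $P\varphi_k=\lambda_k\varphi_k$, $1=\lambda_0\ge\lambda_1\ge\cdots$, and a step number $t$, the manifold coordinates are $\alpha_j=(\lambda_1^t\varphi_1(j),\dots,\lambda_{r_1}^t\varphi_{r_1}(j))\in\mathbb{R}^{r_1}$. Denote by $\bar\alpha,\bar a,\bar b$ and $\sigma_\alpha,\sigma_a,\sigma_b$ the componentwise means and standard deviations of $\{\alpha_j\},\{a_j\},\{b_j\}$, and standardize componentwise: $\widetilde\alpha=(\alpha-\bar\alpha)/\sigma_\alpha$, $\widetilde a=(a-\bar a)/\sigma_a$, $\widetilde b=(b-\bar b)/\sigma_b$. Put $\xi_j=[\widetilde\alpha_j,\widetilde a_j,\widetilde b_j]\in\mathbb{R}^{r_1+r+q}$. The lift mapping is the Gaussian kernel ridge regression $f(\xi)=\sum_{j=1}^m c_j\exp(-\lVert\xi-\xi_j\rVert_2^2/\varepsilon_f)\in\mathbb{R}^n$,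 where $\varepsilon_f=c_\varepsilon\operatorname{median}\{\lVert\xi_i-\xi_j\rVert_2^2:i<j\}$ with $c_\varepsilon>0$, and $C=[c_1,\dots,c_m]^\top$ solves $(K+\lambda_fI)C=[u_1,\dots,u_m]^\top$ with $K_{ij}=\exp(-\lVert\xi_i-\xi_j\rVert_2^2/\varepsilon_f)$, $\lambda_f>0$. Gappy PMD (online). Let $d=r_1+r$ and write $\theta=[\widetilde\alpha,\widetilde a]\in\mathbb{R}^d$. Let $a(\theta)$ be the physical coefficient vector obtained by undoing the standardization of $\widetilde a$. Put $b(a;y)=y-S\bar x-S\Phi a$, $\xi(\theta)=[\widetilde\alpha,\widetilde a,\widetilde b]$ with $\widetilde b$ the standardization of $b(a(\theta);y)$, and $$\mathcal F(\theta;y):=\bar x+\Phi a(\theta)+f(\xi(\theta))\in\mathbb{R}^n .$$ $D_\theta\mathcal F(\theta;y)\in\mathbb{R}^{n\times d}$ is its Jacobian in $\theta$ (with $y$ fixed). The search set $\Theta=[\theta_L,\theta_U]\subset\mathbb{R}^d$ is a box obtained by expanding the range of the training coordinates by a fixed margin. The online problem is to minimize $\lVert R(\theta)\rVert_2^2$ over $\Theta$, where $R(\theta)=b(a(\theta);y)-Sf(\xi(\theta))=y-S\mathcal F(\theta;y)$. *)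

(* Defs.v *)
From HB Require Import structures.
From mathcomp Require Import all_boot all_order all_algebra.
From mathcomp Require Import all_classical all_reals all_analysis.

Set Implicit Arguments.
Unset Strict Implicit.
Unset Printing Implicit Defensive.

Import Order.TTheory GRing.Theory Num.Theory.
Import numFieldNormedType.Exports.

Local Open Scope classical_set_scope.
Local Open Scope ring_scope.

(* Vectors are columns.  The library norm of 'cV[R]_k is the sup norm; it only
   enters through differentiability and interiors, which do not depend on the
   choice of a norm in finite dimension. *)

Definition norm2 (R : realType) k (v : 'cV[R]_k) : R :=
  Num.sqrt (\sum_i v i 0 ^+ 2).

Definition spectral_norm (R : realType) k l (A : 'M[R]_(k, l)) : R :=
  sup [set norm2 (A *m v) | v in [set v : 'cV[R]_l | norm2 v <= 1]].

Definition penrose (R : realType) k l (A : 'M[R]_(k, l)) (B : 'M[R]_(l, k)) :=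
  [/\ A *m B *m A = A, B *m A *m B = B,
      (A *m B)^T = A *m B & (B *m A)^T = B *m A].

Definition mpinv (R : realType) k l (A : 'M[R]_(k, l)) : 'M[R]_(l, k) :=
  xget 0 [set B | penrose A B].

Definition singular_values (R : realType) k l (A : 'M[R]_(k, l)) : set R :=
  [set s | 0 <= s /\ exists (u : 'cV[R]_k) (v : 'cV[R]_l),
    [/\ norm2 u = 1, norm2 v = 1, A *m v = s *: u & A^T *m u = s *: v]].

(* Meant for l <= k and 0 < l, where the set is finite and nonempty and its
   infimum is the l-th largest singular value counted with multiplicity. *)
Definition sigma_min (R : realType) k l (A : 'M[R]_(k, l)) : R :=
  inf (singular_values A).

(* Reduced singular value decomposition A = U diag(s) V^T. *)
Definition is_svd (R : realType) k l (A : 'M[R]_(k, l))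
    (U : 'M[R]_(k, minn k l)) (s : 'rV[R]_(minn k l))
    (V : 'M[R]_(l, minn k l)) : Prop :=
  [/\ A = U *m diag_mx s *m V^T, U^T *m U = 1%:M, V^T *m V = 1%:M,
      forall i, 0 <= s 0 i &
      forall i j : 'I_(minn k l), (i <= j)%N -> s 0 j <= s 0 i].

Definition leading_left_singular (R : realType) k l (A : 'M[R]_(k, l))
    r (Phi : 'M[R]_(k, r)) : Prop :=
  exists U s V (le_r : (r <= minn k l)%N),
    is_svd A U s V /\ Phi = colsub (widen_ord le_r) U.

(* The transpose of the library's 'J, which acts on row vectors. *)
Definition jacobian_mx (R : realType) k l (f : 'cV[R]_k -> 'cV[R]_l)
    (a : 'cV[R]_k) : 'M[R]_(l, k) :=
  \matrix_(i, j) ('D_(delta_mx j 0) f a) i 0.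

Definition gradient (R : realType) k (f : 'cV[R]_k -> R)
    (a : 'cV[R]_k) : 'cV[R]_k :=
  \col_j 'D_(delta_mx j 0) f a.

Definition median (R : realType) (s : seq R) : R :=
  let t := sort <=%R s in let h := (size s)./2 in
  if odd (size s) then t`_h else (t`_h.-1 + t`_h) / 2.

(* Data sets are matrices whose columns are the samples. *)
Definition mean_col (R : realType) l m (V : 'M[R]_(l, m)) : 'cV[R]_l :=
  \col_i (m%:R^-1 * \sum_j V i j).

(* Population standard deviation, normalized by m. *)
Definition sd_col (R : realType) l m (V : 'M[R]_(l, m)) : 'cV[R]_l :=
  \col_i Num.sqrt (m%:R^-1 * \sum_j (V i j - mean_col V i 0) ^+ 2).

(* Columns of W standardized with the statistics of V; a constant component
   of V is sent to 0, since x / 0 = 0. *)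
Definition standardize (R : realType) l m (V : 'M[R]_(l, m))
    k (W : 'M[R]_(l, k)) : 'M[R]_(l, k) :=
  \matrix_(i, j) ((W i j - mean_col V i 0) / sd_col V i 0).

Definition unstandardize (R : realType) l m (V : 'M[R]_(l, m))
    (w : 'cV[R]_l) : 'cV[R]_l :=
  \col_i (mean_col V i 0 + sd_col V i 0 * w i 0).

Definition sampling_mx (R : realType) q n (s : 'I_q -> 'I_n) : 'M[R]_(q, n) :=
  \matrix_(k, j) (s k == j)%:R.

(* Phi, nbr, the eigenpairs and C are not determined by the snapshots and the
   hyperparameters (multiplicities, ties, normalization): they are data,
   constrained by is_gappy_pmd below. *)
Record pmd_data (R : realType) (n m q r r1 : nat) := PmdData {
  pmd_X : 'M[R]_(n, m);              (* snapshots, one per column *)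
  pmd_samp : 'I_q -> 'I_n;           (* sampled indices *)
  pmd_Phi : 'M[R]_(n, r);
  pmd_knn : nat;
  pmd_nbr : 'I_m -> {set 'I_m};      (* the knn nearest neighbors of each u_i *)
  pmd_eps : R;
  pmd_lam : nat -> R;                (* eigenvalues, meaningful below m *)
  pmd_phi : nat -> 'cV[R]_m;         (* eigenvectors, meaningful below m *)
  pmd_t : nat;
  pmd_ceps : R;
  pmd_lamf : R;
  pmd_C : 'M[R]_(m, n);              (* row j is c_j^T *)
  pmd_margin : 'cV[R]_(r1 + r)       (* margin of the box, per coordinate *)
}.

Section GappyPMD.
Context (R : realType) (n m q r r1 : nat) (D : pmd_data R n m q r r1).

Definition pmd_S : 'M[R]_(q, n) := sampling_mx R (pmd_samp D).

Definition pmd_xbar : 'cV[R]_n := mean_col (pmd_X D).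

Definition pmd_Xc : 'M[R]_(n, m) :=
  \matrix_(i, j) (pmd_X D i j - pmd_xbar i 0).

Definition pmd_a : 'M[R]_(r, m) := (pmd_Phi D)^T *m pmd_Xc.

Definition pmd_u : 'M[R]_(n, m) := pmd_Xc - pmd_Phi D *m pmd_a.

Definition pmd_b : 'M[R]_(q, m) := pmd_S *m pmd_u.

Definition pmd_dist (i j : 'I_m) : R := norm2 (col i pmd_u - col j pmd_u).

Definition is_nearest_neighbors : Prop :=
  forall i : 'I_m,
    [/\ i \notin pmd_nbr D i, #|pmd_nbr D i| = pmd_knn D &
        forall j l : 'I_m, j \in pmd_nbr D i -> l \notin pmd_nbr D i ->
          l != i -> pmd_dist i j <= pmd_dist i l].

(* The graph is undirected: i and j are joined as soon as one of them is among
   the nearest neighbors of the other. *)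
Definition pmd_edge : rel 'I_m :=
  [rel i j | (j \in pmd_nbr D i) || (i \in pmd_nbr D j)].

(* Shortest-path distance; +oo between distinct connected components. *)
Definition pmd_geod (i j : 'I_m) : \bar R :=
  ereal_inf [set (\sum_(l <- pairmap pmd_dist i p) l)%:E |
              p in [set p : seq 'I_m | path pmd_edge i p /\ last i p = j]].

Definition pmd_W : 'M[R]_m :=
  \matrix_(i, j)
    fine (expeR (- (pmd_geod i j * pmd_geod i j * (pmd_eps D)^-1%:E))%E).

Definition pmd_rho (i : 'I_m) : R := \sum_j pmd_W i j.

Definition pmd_Wt : 'M[R]_m :=
  \matrix_(i, j) (pmd_W i j / (pmd_rho i * pmd_rho j)).

Definition pmd_P : 'M[R]_m :=
  \matrix_(i, j) (pmd_Wt i j / \sum_k pmd_Wt i k).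

Definition is_ordered_eigenbasis : Prop :=
  [/\ forall k, (k < m)%N -> pmd_P *m pmd_phi D k = pmd_lam D k *: pmd_phi D k,
      \matrix_(j < m, k < m) pmd_phi D k j 0 \in unitmx,
      pmd_lam D 0 = 1 &
      forall k l, (k <= l < m)%N -> pmd_lam D l <= pmd_lam D k].

(* The trivial eigenpair of index 0 is skipped. *)
Definition pmd_alpha : 'M[R]_(r1, m) :=
  \matrix_(k, j) (pmd_lam D k.+1 ^+ pmd_t D * pmd_phi D k.+1 j 0).

Definition pmd_theta : 'M[R]_(r1 + r, m) :=
  col_mx (standardize pmd_alpha pmd_alpha) (standardize pmd_a pmd_a).

Definition pmd_xi : 'M[R]_(r1 + r + q, m) :=
  col_mx pmd_theta (standardize pmd_b pmd_b).

Definition pmd_epsf : R :=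
  pmd_ceps D * median [seq norm2 (col ij.1 pmd_xi - col ij.2 pmd_xi) ^+ 2 |
                        ij <- enum [pred ij : 'I_m * 'I_m | (ij.1 < ij.2)%N]].

Definition pmd_kernel (xi : 'cV[R]_(r1 + r + q)) (j : 'I_m) : R :=
  expR (- (norm2 (xi - col j pmd_xi) ^+ 2 / pmd_epsf)).

Definition pmd_K : 'M[R]_m := \matrix_(i, j) pmd_kernel (col i pmd_xi) j.

Definition pmd_lift (xi : 'cV[R]_(r1 + r + q)) : 'cV[R]_n :=
  \sum_j pmd_kernel xi j *: (row j (pmd_C D))^T.

Record is_gappy_pmd : Prop := IsGappyPMD {
  pmd_samp_inj : injective (pmd_samp D);
  pmd_Phi_svd : leading_left_singular pmd_Xc (pmd_Phi D);
  pmd_knn_bounds : (0 < pmd_knn D < m)%N;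
  pmd_nbrP : is_nearest_neighbors;
  pmd_eps_gt0 : 0 < pmd_eps D;
  pmd_r1_lt : (r1 < m)%N;
  pmd_eigenP : is_ordered_eigenbasis;
  pmd_ceps_gt0 : 0 < pmd_ceps D;
  pmd_lamf_gt0 : 0 < pmd_lamf D;
  pmd_C_solves : (pmd_K + (pmd_lamf D)%:M) *m pmd_C D = pmd_u^T;
  pmd_margin_ge0 : forall k, 0 <= pmd_margin D k 0
}.

(* Online stage: theta stacks the standardized coordinates alpha and a. *)

Definition phys_a (theta : 'cV[R]_(r1 + r)) : 'cV[R]_r :=
  unstandardize pmd_a (dsubmx theta).

Definition resid_b (a : 'cV[R]_r) (y : 'cV[R]_q) : 'cV[R]_q :=
  y - pmd_S *m pmd_xbar - pmd_S *m pmd_Phi D *m a.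

Definition online_xi (y : 'cV[R]_q) (theta : 'cV[R]_(r1 + r)) :
    'cV[R]_(r1 + r + q) :=
  col_mx theta (standardize pmd_b (resid_b (phys_a theta) y)).

Definition pmd_recon (y : 'cV[R]_q) (theta : 'cV[R]_(r1 + r)) : 'cV[R]_n :=
  pmd_xbar + pmd_Phi D *m phys_a theta + pmd_lift (online_xi y theta).

Definition pmd_box : set 'cV[R]_(r1 + r) :=
  [set theta | forall k,
     inf (range (pmd_theta k)) - pmd_margin D k 0 <= theta k 0
       <= sup (range (pmd_theta k)) + pmd_margin D k 0].

Definition pmd_objective (y : 'cV[R]_q) (theta : 'cV[R]_(r1 + r)) : R :=
  norm2 (y - pmd_S *m pmd_recon y theta) ^+ 2.

Definition interior_stationary (y : 'cV[R]_q) (theta : 'cV[R]_(r1 + r)) :=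
  interior pmd_box theta /\ gradient (pmd_objective y) theta = 0.

End GappyPMD.

(* Main.v *)
(** Write [A = S Psi] and [B] for its pseudo-inverse, a left inverse of [A] equal
    to [(A^T A)^-1 A^T].  Since [e - eperp] lies in the range of [Psi], the error
    identity is linear algebra.  The factor [Lam] in front of [|eperp|] (instead
    of [1 + Lam]) comes from the fact that an oblique projection and its
    complement have the same norm.  [Lam = 1 / sigma_min A] because a maximizer
    of [|B w|] on the unit ball, which exists by compactness, is a left singular
    vector of [A].  At a stationary point the chain rule gives
    [J^T S^T (y - S xt) = 0], and the rows of [Psi^T] are in the row space of
    [J^T]. *)

Require Import Defs.
From HB Require Import structures.
From mathcomp Require Import all_boot all_order all_algebra.
From mathcomp Require Import all_classical all_reals all_analysis.
From mathcomp Require Import ring lra.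

Import Order.TTheory GRing.Theory Num.Theory.
Import numFieldNormedType.Exports.

Local Open Scope classical_set_scope.
Local Open Scope ring_scope.

(** * Euclidean inner product and norm *)

Definition dot {R : realType} {k} (u v : 'cV[R]_k) : R := (u^T *m v) 0 0.

Lemma dotE {R : realType} {k} (u v : 'cV[R]_k) :
  dot u v = \sum_i u i 0 * v i 0.
Proof. by rewrite /dot mxE; apply: eq_bigr => i _; rewrite mxE. Qed.

Lemma dotC {R : realType} {k} (u v : 'cV[R]_k) : dot u v = dot v u.
Proof. by rewrite !dotE; apply: eq_bigr => i _; rewrite mulrC. Qed.

Lemma dotDl {R : realType} {k} (u v w : 'cV[R]_k) :
  dot (u + v) w = dot u w + dot v w.
Proof. by rewrite /dot linearD mulmxDl mxE. Qed.

Lemma dotDr {R : realType} {k} (u v w : 'cV[R]_k) :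
  dot u (v + w) = dot u v + dot u w.
Proof. by rewrite /dot mulmxDr mxE. Qed.

Lemma dotZl {R : realType} {k} a (u v : 'cV[R]_k) :
  dot (a *: u) v = a * dot u v.
Proof. by rewrite /dot linearZ -scalemxAl mxE. Qed.

Lemma dotZr {R : realType} {k} a (u v : 'cV[R]_k) :
  dot u (a *: v) = a * dot u v.
Proof. by rewrite dotC dotZl dotC. Qed.

Lemma dotNl {R : realType} {k} (u v : 'cV[R]_k) : dot (- u) v = - dot u v.
Proof. by rewrite -scaleN1r dotZl mulN1r. Qed.

Lemma dotNr {R : realType} {k} (u v : 'cV[R]_k) : dot u (- v) = - dot u v.
Proof. by rewrite dotC dotNl dotC. Qed.

Lemma dot_mull {R : realType} {k l} (A : 'M[R]_(k, l)) u v :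
  dot (A *m u) v = dot u (A^T *m v).
Proof. by rewrite /dot trmx_mul mulmxA. Qed.

Lemma norm2_ge0 {R : realType} {k} (v : 'cV[R]_k) : 0 <= norm2 v.
Proof. exact: sqrtr_ge0. Qed.

Lemma sqr_norm2 {R : realType} {k} (v : 'cV[R]_k) : norm2 v ^+ 2 = dot v v.
Proof.
rewrite dotE sqr_sqrtr; first by apply: eq_bigr => i _; rewrite expr2.
by apply: sumr_ge0 => i _; rewrite sqr_ge0.
Qed.

Lemma norm2_dot {R : realType} {k} (v : 'cV[R]_k) :
  norm2 v = Num.sqrt (dot v v).
Proof. by rewrite -sqr_norm2 sqrtr_sqr ger0_norm ?norm2_ge0. Qed.

Lemma norm2_le {R : realType} {k} (v : 'cV[R]_k) (a : R) :
  0 <= a -> (norm2 v <= a) = (dot v v <= a ^+ 2).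
Proof. by move=> a0; rewrite -sqr_norm2 ler_sqr // nnegrE ?norm2_ge0. Qed.

Lemma norm20 {R : realType} {k} : norm2 (0 : 'cV[R]_k) = 0.
Proof. by rewrite norm2_dot /dot mulmx0 mxE sqrtr0. Qed.

Lemma norm2_eq0 {R : realType} {k} (v : 'cV[R]_k) : (norm2 v == 0) = (v == 0).
Proof.
apply/eqP/eqP => [v0|->]; last exact: norm20.
have := sqr_norm2 v; rewrite v0 expr0n /= dotE => /esym/eqP.
rewrite psumr_eq0 => [/allP vi0|i _]; last by rewrite -expr2 sqr_ge0.
apply/colP => i; have := vi0 i; rewrite mem_index_enum => /(_ isT).
by rewrite /= -expr2 sqrf_eq0 mxE => /eqP.
Qed.

Lemma norm2Z {R : realType} {k} a (v : 'cV[R]_k) :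
  norm2 (a *: v) = `|a| * norm2 v.
Proof.
by rewrite !norm2_dot dotZl dotZr mulrA -expr2 sqrtrM ?sqr_ge0// sqrtr_sqr.
Qed.

Lemma norm2N {R : realType} {k} (v : 'cV[R]_k) : norm2 (- v) = norm2 v.
Proof. by rewrite !norm2_dot dotNl dotNr opprK. Qed.

Lemma dot_le_norm2 {R : realType} {k} (u v : 'cV[R]_k) :
  dot u v <= norm2 u * norm2 v.
Proof.
have [/eqP|u0] := eqVneq (norm2 u) 0.
  by rewrite norm2_eq0 => /eqP ->; rewrite norm20 mul0r /dot trmx0 mul0mx mxE.
have [/eqP|v0] := eqVneq (norm2 v) 0.
  by rewrite norm2_eq0 => /eqP ->; rewrite norm20 mulr0 /dot mulmx0 mxE.
have uv0 : 0 < 2 * (norm2 u * norm2 v).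
  by rewrite !mulr_gt0// lt_neqAle eq_sym ?u0 ?v0 norm2_ge0.
rewrite -subr_ge0 -(pmulr_rge0 _ uv0).
have := sqr_ge0 (norm2 (norm2 v *: u - norm2 u *: v)).
rewrite sqr_norm2 dotDl !dotDr !dotNl !dotNr !dotZl !dotZr -!sqr_norm2.
by rewrite (dotC v u); congr (0 <= _); ring.
Qed.

Lemma norm2D {R : realType} {k} (u v : 'cV[R]_k) :
  norm2 (u + v) <= norm2 u + norm2 v.
Proof.
rewrite norm2_le ?addr_ge0 ?norm2_ge0//.
have := dot_le_norm2 u v; rewrite dotDl !dotDr (dotC v u) -!sqr_norm2.
by move=> ?; lra.
Qed.

(** * Spectral norm as a maximum over the unit ball *)

Lemma continuous_norm2_mulmx {R : realType} {k l} (A : 'M[R]_(k, l)) :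
  continuous (fun v : 'rV[R]_l => norm2 (A *m v^T)).
Proof.
have cont_sum m (F : 'I_m -> 'rV[R]_l -> R) :
    (forall i, continuous (F i)) -> continuous (fun v => \sum_i F i v).
  by move=> cF; apply: continuous_big => //; exact: add_continuous.
have cont_coord i : continuous (fun v : 'rV[R]_l => (A *m v^T) i 0).
  have -> : (fun v : 'rV[R]_l => (A *m v^T) i 0) =
            (fun v : 'rV[R]_l => \sum_j A i j * v 0 j).
    by apply/funext => v; rewrite mxE; apply: eq_bigr => j _; rewrite mxE.
  apply: cont_sum => j v.
  apply: (@continuousM _ _ (fun=> A i j) (fun v : 'rV[R]_l => v 0 j)).
    exact: cst_continuous.
  exact: coord_continuous.
move=> v; apply: (@continuous_comp _ _ _
  (fun v : 'rV[R]_l => \sum_i (A *m v^T) i 0 ^+ 2) Num.sqrt);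
  last exact: sqrt_continuous.
apply: cont_sum => i {}v; apply: (@continuous_comp _ _ _
  (fun v : 'rV[R]_l => (A *m v^T) i 0) (fun t => t ^+ 2));
  [exact: cont_coord|exact: exprn_continuous].
Qed.

Lemma spectral_norm_attained {R : realType} {k l} (A : 'M[R]_(k, l)) :
  (exists2 w, norm2 w <= 1 & norm2 (A *m w) = spectral_norm A) /\
  (forall w, norm2 w <= 1 -> norm2 (A *m w) <= spectral_norm A).
Proof.
(* Row vectors match [EVT_max_rV]; the factor [1%:M] gives the norm the form covered by
   [continuous_norm2_mulmx]. *)
pose B := [set v : 'rV[R]_l | norm2 (1%:M *m v^T) <= 1].
have B0 : B !=set0 by exists 0; rewrite /B /= trmx0 mulmx0 norm20.
have cB : compact B.
  apply: bounded_closed_compact.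
    (* Each entry is at most the Euclidean norm, so the ball is bounded for the sup norm. *)
    exists 1; split => // M M1 v; rewrite /B /= mul1mx => v1.
    rewrite /Num.norm /= mx_normrE; apply: bigmax_le => [|[i j] _] /=.
      exact: le_trans (ltW M1).
    apply: le_trans (ltW M1); apply: le_trans v1.
    rewrite -sqrtr_sqr ler_sqrt; last by apply: sumr_ge0 => *; exact: sqr_ge0.
    rewrite (bigD1 j) //= mxE (ord1 i) lerDl.
    by apply: sumr_ge0 => *; exact: sqr_ge0.
  apply: (@preimage_closed _ _ (fun v : 'rV[R]_l => norm2 (1%:M *m v^T))
            [set x | x <= 1]) => [v _|]; last exact: closed_le.
  exact: continuous_norm2_mulmx.
have [w Bw maxw] := EVT_max_rV B0 cB
  (continuous_subspaceT (continuous_norm2_mulmx A)).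
have {}maxw v : norm2 v <= 1 -> norm2 (A *m v) <= norm2 (A *m w^T).
  move=> v1; have := maxw v^T; rewrite trmxK; apply.
  by rewrite inE /B /= trmxK mul1mx.
have wE : norm2 (A *m w^T) = spectral_norm A.
  have ubw : ubound [set norm2 (A *m v) | v in [set v : 'cV[R]_l | norm2 v <= 1]]
      (norm2 (A *m w^T)) by move=> _ [v v1 <-]; exact: maxw.
  have inw : [set norm2 (A *m v) | v in [set v : 'cV[R]_l | norm2 v <= 1]]
      (norm2 (A *m w^T)).
    by exists w^T => //=; move: Bw; rewrite inE /B /= mul1mx.
  apply/eqP; rewrite eq_le; apply/andP; split.
    by apply: sup_upper_bound => //; split; exists (norm2 (A *m w^T)).
  by apply: ge_sup => //; exists (norm2 (A *m w^T)).
split; last by rewrite -wE.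
by exists w^T => //; move: Bw; rewrite inE /B /= mul1mx.
Qed.

Lemma spectral_norm_ge0 {R : realType} {k l} (A : 'M[R]_(k, l)) :
  0 <= spectral_norm A.
Proof.
have [_ /(_ 0)] := spectral_norm_attained A.
by rewrite mulmx0 !norm20; apply.
Qed.

Lemma norm2_mulmx_le {R : realType} {k l} (A : 'M[R]_(k, l)) v :
  norm2 (A *m v) <= spectral_norm A * norm2 v.
Proof.
have [->|v0] := eqVneq v 0; first by rewrite mulmx0 !norm20 mulr0.
have nv : 0 < norm2 v by rewrite lt_neqAle eq_sym norm2_eq0 v0 norm2_ge0.
have [_ /(_ ((norm2 v)^-1 *: v))] := spectral_norm_attained A.
rewrite -scalemxAr !norm2Z gtr0_norm ?invr_gt0// mulVf ?gt_eqF//.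
by rewrite lexx ler_pdivrMl// mulrC => ->.
Qed.

(** Cauchy-Schwarz on [|A^T v|^2 = <v, A A^T v>], followed by division by [|A^T v|]. *)
Lemma norm2_trmx_mulmx_le {R : realType} {k l} (A : 'M[R]_(k, l)) v :
  norm2 (A^T *m v) <= spectral_norm A * norm2 v.
Proof.
have [->|u0] := eqVneq (A^T *m v) 0.
  by rewrite norm20 mulr_ge0 ?spectral_norm_ge0 ?norm2_ge0.
have nu : 0 < norm2 (A^T *m v).
  by rewrite lt_neqAle eq_sym norm2_eq0 u0 norm2_ge0.
rewrite -(ler_pM2r nu) -expr2 sqr_norm2 dot_mull trmxK.
apply: le_trans (dot_le_norm2 _ _) _.
by rewrite [leRHS]mulrAC [leRHS]mulrC ler_wpM2l ?norm2_ge0 ?norm2_mulmx_le.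
Qed.

(** * Pseudo-inverse of a matrix of full column rank *)

Lemma row_free_gram {R : realType} {k l} (A : 'M[R]_(k, l)) :
  \rank A = l -> A^T *m A \in unitmx.
Proof.
move=> rkA; rewrite -row_free_unit; apply: inj_row_free => v vA0.
have Av0 : A *m v^T = 0.
  apply/eqP; rewrite -norm2_eq0 -sqrf_eq0 sqr_norm2 dot_mull.
  have -> : A^T *m (A *m v^T) = (v *m (A^T *m A))^T.
    by rewrite !trmx_mul trmxK mulmxA.
  by rewrite vA0 /dot trmx0 mulmx0 mxE.
have freeA : row_free A^T by rewrite /row_free mxrank_tr rkA.
apply: (row_free_inj freeA); rewrite mul0mx.
by rewrite -[v]trmxK -trmx_mul Av0 trmx0.
Qed.

(** [mpinv] is a choice among Penrose inverses: [(A^T A)^-1 A^T] shows that one exists, and the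
    first and third Penrose conditions then force the choice to be this matrix. *)
Lemma mpinv_full_rank {R : realType} {k l} {A : 'M[R]_(k, l)} :
  \rank A = l ->
  [/\ mpinv A *m A = 1%:M, (A *m mpinv A)^T = A *m mpinv A,
      mpinv A = invmx (A^T *m A) *m A^T &
      mpinv A *m (mpinv A)^T = invmx (A^T *m A)].
Proof.
move=> /row_free_gram uG; set G := A^T *m A in uG *.
have Gt : (invmx G)^T = invmx G by rewrite trmx_inv /G trmx_mul trmxK.
have BA : invmx G *m A^T *m A = 1%:M by rewrite -mulmxA mulVmx.
have [ABA _ ABt _] : penrose A (mpinv A).
  apply: xgetPex; exists (invmx G *m A^T).
  split; rewrite ?BA ?mul1mx ?trmx1//; first by rewrite -mulmxA BA mulmx1.
  by rewrite !trmx_mul trmxK Gt mulmxA.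
have BE : mpinv A = invmx G *m A^T.
  (* [A^T A B = A^T (A B)^T = (A B A)^T = A^T], for [B = mpinv A]. *)
  rewrite -[LHS](mulKmx uG) /G -(mulmxA A^T) -ABt.
  by rewrite -trmx_mul ABA.
split => //; first by rewrite BE.
by rewrite BE trmx_mul trmxK mulmxA BA mul1mx.
Qed.

Lemma spectral_norm_mpinv {R : realType} {k l} {A : 'M[R]_(k, l)} :
  (0 < l)%N -> \rank A = l -> spectral_norm (mpinv A) = (sigma_min A)^-1.
Proof.
move=> l0 rkA; have [BA ABt BE _] := mpinv_full_rank rkA.
set B := mpinv A in BA ABt BE *; set L := spectral_norm B.
have ABBt : A *m B *m B^T = B^T.
  by rewrite -ABt -trmx_mul mulmxA BA mul1mx.
(* [B] cannot vanish, since [B A = I] fixes a basis vector, available as [0 < l]. *)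
have L0 : 0 < L.
  rewrite lt_neqAle spectral_norm_ge0 andbT eq_sym; apply/eqP => L0.
  have := norm2_mulmx_le B (A *m delta_mx (Ordinal l0) 0).
  rewrite mulmxA BA mul1mx -/L L0 mul0r => d0.
  have : norm2 (delta_mx (Ordinal l0) 0 : 'cV[R]_l) == 0.
    by rewrite eq_le d0 norm2_ge0.
  rewrite norm2_eq0 => /eqP/colP/(_ (Ordinal l0))/eqP.
  by rewrite !mxE !eqxx oner_eq0.
(* From [A v = s u] and [B A = I], the vector [s B u = v] has norm 1, whereas [|B u| <= L]. *)
have lbL : lbound (singular_values A) L^-1.
  move=> s [s0 [u [v [u1 v1 Av _]]]].
  have : norm2 (s *: (B *m u)) = 1 by rewrite scalemxAr -Av mulmxA BA mul1mx.
  rewrite norm2Z ger0_norm// => sBu.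
  rewrite -[leLHS]mulr1 -sBu mulrCA ler_piMr// ler_pdivrMl// mulr1.
  by rewrite -[leRHS]mulr1 -u1 norm2_mulmx_le.
have svL : singular_values A L^-1.
  have [[w w1 Bw] _] := spectral_norm_attained B; rewrite -/L in Bw.
  have {}w1 : norm2 w = 1.
    apply/eqP; rewrite eq_le w1 -(ler_pM2l L0) mulr1 -{1}Bw.
    exact: norm2_mulmx_le.
  (* Equality case: [|B^T B w - L^2 w|^2 = |B^T B w|^2 - 2 L^2 |B w|^2 + L^4], which is at most
     [L^4 - 2 L^4 + L^4 = 0]. *)
  have BtBw : B^T *m (B *m w) = L ^+ 2 *: w.
    apply/eqP; rewrite -subr_eq0 -norm2_eq0 -sqrf_eq0 eq_le sqr_ge0 andbT.
    rewrite sqr_norm2 dotDl !dotDr !dotNl !dotNr !dotZl !dotZr (dotC w).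
    rewrite -!sqr_norm2 dot_mull trmxK -sqr_norm2 Bw w1.
    have : norm2 (B^T *m (B *m w)) <= L ^+ 2.
      by rewrite expr2 -{2}Bw norm2_trmx_mulmx_le.
    have := norm2_ge0 (B^T *m (B *m w)).
    move: (norm2 _) => a a0 aL.
    have : a ^+ 2 <= (L ^+ 2) ^+ 2 by rewrite ler_sqr ?nnegrE ?sqr_ge0.
    by move=> ?; lra.
  (* By [BtBw], [w] lies in the range of [B^T], which [A B] fixes by [ABBt]. *)
  have ABw : A *m (B *m w) = w.
    apply: (@scalerI _ _ (L ^+ 2)); first by rewrite sqrf_eq0 gt_eqF.
    by rewrite 2!scalemxAr -BtBw !mulmxA ABBt.
  split; first by rewrite invr_ge0 ltW.
  exists w, (L^-1 *: (B *m w)); split => //.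
  - by rewrite norm2Z Bw gtr0_norm ?invr_gt0// mulVf ?gt_eqF.
  - by rewrite -scalemxAr ABw.
  apply: (@scalerI _ _ (L ^+ 2)); first by rewrite sqrf_eq0 gt_eqF.
  rewrite scalemxAr -BtBw (mulmxA A^T) -trmx_mul BA trmx1 mul1mx !scalerA.
  by rewrite expr2 mulfK ?gt_eqF// mulfV ?gt_eqF// scale1r.
have <- : L^-1 = sigma_min A; last by rewrite invrK.
apply/eqP; rewrite eq_le; apply/andP; split.
  by apply: lb_le_inf => //; exists L^-1.
by apply: ge_inf => //; exists L^-1.
Qed.

(** * Isometries, sampling and oblique projections *)

Lemma norm2_isometry {R : realType} {k l} {A : 'M[R]_(k, l)} v :
  A^T *m A = 1%:M -> norm2 (A *m v) = norm2 v.
Proof. by move=> AtA; rewrite !norm2_dot dot_mull mulmxA AtA mul1mx. Qed.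

(** [A^T] is an isometry, so [|A v|^2 = <v, A^T A v> <= |v| |A v|]. *)
Lemma norm2_coisometry_le {R : realType} {k l} {A : 'M[R]_(k, l)} v :
  A *m A^T = 1%:M -> norm2 (A *m v) <= norm2 v.
Proof.
move=> AAt; have [->|Av0] := eqVneq (A *m v) 0.
  by rewrite norm20 norm2_ge0.
have nAv : 0 < norm2 (A *m v).
  by rewrite lt_neqAle eq_sym norm2_eq0 Av0 norm2_ge0.
rewrite -(ler_pM2r nAv) -expr2 sqr_norm2 dot_mull.
apply: le_trans (dot_le_norm2 _ _) _.
by rewrite (@norm2_isometry _ _ _ A^T) ?trmxK.
Qed.

Lemma sampling_mx_coisometry {R : realType} {q n} {s : 'I_q -> 'I_n} :
  injective s -> sampling_mx R s *m (sampling_mx R s)^T = 1%:M.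
Proof.
move=> s_inj; apply/matrixP => i j.
rewrite !mxE (bigD1 (s i)) //= !mxE eqxx mul1r.
rewrite big1 ?addr0 => [|k /negbTE ks]; first by rewrite (inj_eq s_inj) eq_sym.
by rewrite !mxE eq_sym ks mul0r.
Qed.

(* [Psi (S Psi)^+ S] is an oblique projection P of norm at most L; in the plane
   spanned by [w] and [Psi c], where [c = (S Psi)^+ S w], the vector
   [|w|^2 Psi c + |c|^2 w] is orthogonal to [w - Psi c], which P annihilates,
   and this yields the bound L for the complement too. *)
Lemma norm2_oblique_compl_le {R : realType} {q n p} {S : 'M[R]_(q, n)}
    {Psi : 'M[R]_(n, p)} {w : 'cV[R]_n} :
  S *m S^T = 1%:M -> Psi^T *m Psi = 1%:M -> (0 < p)%N ->
  \rank (S *m Psi) = p -> Psi^T *m w = 0 ->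
  norm2 (w - Psi *m mpinv (S *m Psi) *m S *m w) <=
    spectral_norm (mpinv (S *m Psi)) * norm2 w.
Proof.
move=> SSt PsiPsi p0 rkA Pw; have [BA _ _ _] := mpinv_full_rank rkA.
set B := mpinv _ in BA *; set L := spectral_norm B.
have BSle v : norm2 (B *m (S *m v)) <= L * norm2 v.
  apply: le_trans (norm2_mulmx_le _ _) _.
  by rewrite ler_wpM2l ?spectral_norm_ge0 ?norm2_coisometry_le.
set c := B *m (S *m w).
have -> : Psi *m B *m S *m w = Psi *m c by rewrite !mulmxA.
have wc : dot w (Psi *m c) = 0 by rewrite dotC dot_mull Pw /dot mulmx0 mxE.
have BSPsi v : B *m (S *m (Psi *m v)) = v.
  by rewrite [S *m _]mulmxA mulmxA BA mul1mx.
(* If [c = 0] the left side is [|w|], and [1 <= L] because the projection fixes the unit vector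
   [Psi *m delta_mx (Ordinal p0) 0]. *)
have [c0|c0] := eqVneq c 0.
  rewrite c0 mulmx0 subr0 ler_peMl ?norm2_ge0//.
  have := BSle (Psi *m delta_mx (Ordinal p0) 0).
  rewrite BSPsi norm2_isometry// -[leLHS]mul1r ler_pM2r// lt_neqAle norm2_ge0.
  rewrite andbT eq_sym norm2_eq0; apply/eqP => /colP/(_ (Ordinal p0))/eqP.
  by rewrite !mxE !eqxx oner_eq0.
have nc : 0 < norm2 c by rewrite lt_neqAle eq_sym norm2_eq0 c0 norm2_ge0.
set z := w - Psi *m c.
have z2 : norm2 z ^+ 2 = norm2 w ^+ 2 + norm2 c ^+ 2.
  rewrite sqr_norm2 dotDl !dotDr !dotNl !dotNr (dotC _ w) wc -!sqr_norm2.
  by rewrite (norm2_isometry _ PsiPsi); ring.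
have nz : 0 < norm2 z.
  rewrite lt_neqAle norm2_ge0 andbT eq_sym -sqrf_eq0 z2.
  by rewrite gt_eqF// ltr_wpDl ?sqr_ge0// exprn_gt0.
pose v := norm2 w ^+ 2 *: (Psi *m c) + norm2 c ^+ 2 *: w.
(* By orthogonality [|v|^2 = |w|^4 |c|^2 + |c|^4 |w|^2 = |w|^2 |c|^2 |z|^2]. *)
have nv : norm2 v = norm2 w * norm2 c * norm2 z.
  rewrite norm2_dot dotDl !dotDr !dotZl !dotZr (dotC _ w) wc -!sqr_norm2.
  rewrite (norm2_isometry _ PsiPsi) -[RHS]ger0_norm ?mulr_ge0 ?norm2_ge0//.
  by rewrite -sqrtr_sqr !exprMn z2; congr Num.sqrt; ring.
have Bv : B *m (S *m v) = norm2 z ^+ 2 *: c.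
  by rewrite !mulmxDr -!scalemxAr BSPsi -/c -scalerDl z2.
(* This reads [|z|^2 |c| <= L |w| |c| |z|]; the positive factor [|c| |z|] cancels. *)
have := BSle v; rewrite Bv nv norm2Z ger0_norm ?sqr_ge0//.
have -> : norm2 z ^+ 2 * norm2 c = norm2 z * (norm2 c * norm2 z) by ring.
have -> : L * (norm2 w * norm2 c * norm2 z) =
          L * norm2 w * (norm2 c * norm2 z) by ring.
by rewrite ler_pM2r ?mulr_gt0.
Qed.

(** * Gradient of the least-squares objective *)

(** The objective is a finite sum of squares of scalar functions [G i], each affine in the entries
    of [F], so the scalar derivation rules apply termwise. *)
Lemma derive_sqr_norm2_resid {R : realType} {d n q} (A : 'M[R]_(q, n))
    (y : 'cV[R]_q) (F : 'cV[R]_d -> 'cV[R]_n) (t v : 'cV[R]_d) :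
  derivable F t v ->
  'D_v (fun t => norm2 (y - A *m F t) ^+ 2) t =
    - 2 * dot ('D_v F t) (A^T *m (y - A *m F t)).
Proof.
move=> dF; pose G i := fun t => (y - A *m F t) i 0.
have dFj j : is_derive t v (fun t => F t j 0) (('D_v F t) j 0).
  rewrite derive_mx// mxE; apply: derivableP.
  by move/derivable_mxP : dF => /(_ j 0).
have dG i : is_derive t v (G i) (- (A *m 'D_v F t) i 0).
  have -> : G i = cst (y i 0) - \sum_j A i j *: (fun t => F t j 0).
    apply/funext => u; rewrite /G !mxE !fctE /=; congr (_ - _).
    by rewrite fct_sumE; apply: eq_bigr.
  apply: is_derive_eq.
  by rewrite sub0r mxE.
have -> : (fun t => norm2 (y - A *m F t) ^+ 2) = \sum_i G i ^+ 2.
  apply/funext => u; rewrite sqr_norm2 dotE fct_sumE.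
  by apply: eq_bigr => i _; rewrite fctE expr2.
rewrite (@derive_val _ _ _ _ _ _ _
  (is_derive_sum (fun i => is_deriveX 2 (dG i)))).
rewrite -dot_mull dotE mulr_sumr; apply: eq_bigr => i _.
by rewrite /G /= expr1 /GRing.scale /=; ring.
Qed.

Lemma gradient_sqr_norm2_resid {R : realType} {d n q} (A : 'M[R]_(q, n))
    (y : 'cV[R]_q) (F : 'cV[R]_d -> 'cV[R]_n) (t : 'cV[R]_d) :
  differentiable F t ->
  gradient (fun t => norm2 (y - A *m F t) ^+ 2) t =
    - 2 *: ((jacobian_mx F t)^T *m (A^T *m (y - A *m F t))).
Proof.
move=> dF; apply/colP => j; rewrite 2!mxE derive_sqr_norm2_resid;
  last exact: diff_derivable.
rewrite mxE; congr (_ * _); rewrite dotE; apply: eq_bigr => i _.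
by rewrite !mxE.
Qed.

(** * Error identity, error bound and the stationary case *)

Theorem theorem1 (R : realType) (n m q r r1 : nat)
    (D : pmd_data R n m q r r1) (D_ok : is_gappy_pmd D)
    (x : 'cV[R]_n) (eta : 'cV[R]_q) :
  let S := pmd_S D in
  let y : 'cV[R]_q := S *m x + eta in
  let F := pmd_recon D y in
  forall theta : 'cV[R]_(r1 + r),
  pmd_box D theta ->
  differentiable F theta ->
  let xt : 'cV[R]_n := F theta in
  let e : 'cV[R]_n := x - xt in
  let J := jacobian_mx F theta in
  forall (p : nat) (Psi : 'M[R]_(n, p)),
  p = \rank J ->
  Psi^T *m Psi = 1%:M ->
  (Psi^T :=: J^T)%MS ->
  let Psis := S *m Psi in
  let eperp := (1%:M - Psi *m Psi^T) *m e in
  (1 <= p <= q)%N ->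
  \rank Psis = p ->
  let Lam := spectral_norm (mpinv Psis) in
  let rstat := Psi^T *m S^T *m (y - S *m xt) in
  [/\ Lam = (sigma_min Psis)^-1,
      e = eperp - Psi *m mpinv Psis *m (S *m eperp + eta)
          + Psi *m invmx (Psis^T *m Psis) *m rstat,
      norm2 e <= Lam * (norm2 eperp + norm2 eta) + Lam ^+ 2 * norm2 rstat &
      interior_stationary D y theta ->
      [/\ rstat = 0,
          e = eperp - Psi *m mpinv Psis *m (S *m eperp + eta) &
          norm2 e <= Lam * (norm2 eperp + norm2 eta)]].
Proof.
move=> S y F theta _ dF xt e J p Psi _ PsiPsi rangePsi Psis eperp /andP[p0 _].
move=> rkPsis Lam rstat.
have SSt : S *m S^T = 1%:M := sampling_mx_coisometry (pmd_samp_inj D_ok).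
have [BA _ BE BBt] := mpinv_full_rank rkPsis.
have yE : y - S *m xt = S *m e + eta by rewrite /y /e mulmxBr addrAC.
have eE : e = eperp + Psi *m (Psi^T *m e).
  by rewrite /eperp mulmxBl mul1mx mulmxA subrK.
have PsiEperp : Psi^T *m eperp = 0.
  rewrite /eperp mulmxA (mulmxBr Psi^T) mulmx1 mulmxA PsiPsi mul1mx subrr.
  by rewrite mul0mx.
(* The left side is [B (y - S xt)] with [B = mpinv Psis]; splitting [e] by [eE] and using
   [B S Psi = I] isolates the in-range coordinates [Psi^T e]. *)
have rE : invmx (Psis^T *m Psis) *m rstat =
          mpinv Psis *m (S *m eperp + eta) + Psi^T *m e.
  rewrite /rstat -trmx_mul mulmxA -BE yE {1}eE (mulmxDr S) (mulmxA S Psi).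
  by rewrite addrAC -/Psis [LHS]mulmxDr (mulmxA _ Psis) BA mul1mx.
have id1 : e = eperp - Psi *m mpinv Psis *m (S *m eperp + eta)
          + Psi *m invmx (Psis^T *m Psis) *m rstat.
  by rewrite -!mulmxA rE (mulmxDr Psi) addrA subrK.
have bd : norm2 e <= Lam * (norm2 eperp + norm2 eta) + Lam ^+ 2 * norm2 rstat.
  (* Regrouping keeps [eperp - Psi B S eperp] as a single vector, to which the oblique complement
     bound applies; a triangle inequality there would cost [1 + Lam]. *)
  rewrite {1}id1 mulmxDr opprD addrA mulmxA.
  apply: le_trans (norm2D _ _) (lerD _ _).
    rewrite mulrDr; apply: le_trans (norm2D _ _) (lerD _ _).
      exact: norm2_oblique_compl_le.
    by rewrite norm2N -mulmxA norm2_isometry// norm2_mulmx_le.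
  (* [(A^T A)^-1 = B B^T]: each factor contributes one [Lam]. *)
  rewrite -mulmxA norm2_isometry// -BBt -mulmxA expr2 -mulrA.
  apply: le_trans (norm2_mulmx_le _ _) _.
  by rewrite ler_wpM2l ?spectral_norm_ge0 ?norm2_trmx_mulmx_le.
split => //; first exact: spectral_norm_mpinv.
move=> [_ /eqP]; rewrite /pmd_objective gradient_sqr_norm2_resid//.
rewrite scaler_eq0 oppr_eq0 pnatr_eq0 /= => /eqP Jr0.
have r0 : rstat = 0.
  have /submxP[M PsiM] : (Psi^T <= J^T)%MS by rewrite rangePsi.
  by rewrite /rstat PsiM -!mulmxA Jr0 mulmx0.
split => //; first by rewrite {1}id1 r0 mulmx0 addr0.
by move: bd; rewrite r0 norm20 mulr0 addr0.
Qed.
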